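(* Let $r>0$ and let $M$ be a finite set endowed with two metrics $d_0$ and $d_1$ such that for all $x,y\in M$ $$|d_0(x,y)-d_1(x,y)|\le 2r,$$ and such that for $i=0,1$ the metric space $(M,d_i)$ embeds into $L_1$ with distortion at most $D_i$. Suppose also that there exists a constant $C>0$ such that for all $x,y\in M$ $$d_1(x,y)\le C\,d_0(x,y).$$ Then the $r$-twisted union $(M\times\mathbb{F}_2,d)$ of $(M,d_0)$ and $(M,d_1)$ embeds into $L_1$ with distortion bounded by a constant $D$ that depends only on $D_0$, $D_1$ and $C$.
   Context: $\mathbb{F}_2=\{0,1\}$. $L_1$ stands for a space $L_1(\Omega,\Sigma,\mu)$; embedding into $L_1$ means embedding into some such space. An injective map $F:(X,d_X)\to(Y,d_Y)$ between metric spaces is a bilipschitz embedding if there are $C_1,C_2>0$ with $C_1d_X(u,v)\le d_Y(F(u),F(v))\le C_2d_X(u,v)$ for all $u,v\in X$; its distortion is $\mathrm{Lip}(F)\cdot\mathrm{Lip}(F^{-1}|_{F(X)})$, where $\mathrm{Lip}$ denotes the Lipschitz constant. Twisted union: Let $M$ be a finite set endowed with two metrics $d_0,d_1$ and let $r>0$ be a constant such that $|d_0(x,y)-d_1(x,y)|\le 2r$ for all $x,y\in M$. The $r$-twisted union of $(M,d_0)$ and $(M,d_1)$ is the set $M\times\mathbb{F}_2$ with the metric $d$ defined as the shortest path metric of the weighted graph on $M\times\mathbb{F}_2$ with the following edges: for all $x,y\in M$, an edge between $(x,0)$ and $(y,0)$ of weight $d_0(x,y)$; for all $x,y\in M$,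 an edge between $(x,1)$ and $(y,1)$ of weight $d_1(x,y)$; for every $x\in M$, an edge between $(x,0)$ and $(x,1)$ of weight $r$. *)

(* Defs.v *)
From HB Require Import structures.
From mathcomp Require Import all_boot all_order all_algebra.
From mathcomp Require Import all_classical all_reals all_analysis.

Set Implicit Arguments.
Unset Strict Implicit.
Unset Printing Implicit Defensive.
Import Order.TTheory GRing.Theory Num.Theory.

Local Open Scope classical_set_scope.
Local Open Scope ring_scope.

(* Several metrics live on the same carrier, so a metric is a predicate on
   functions rather than a metricType structure. *)
Record is_metric (R : realType) (X : Type) (d : X -> X -> R) : Prop := IsMetric {
  metric_ge0 : forall x y, 0 <= d x y;
  metric_eq0 : forall x y, d x y = 0 <-> x = y;
  metric_symm : forall x y, d x y = d y x;
  metric_triangle : forall x y z, d x z <= d x y + d y z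
}.

Section Lipschitz.
Context {R : realType} {X Y : Type} (dX : X -> X -> R) (dY : Y -> Y -> R).

(* The value is +oo when f is not Lipschitz. *)
Definition Lip (f : X -> Y) : \bar R :=
  ereal_inf [set K%:E | K in
    [set K : R | 0 <= K /\ forall u v, dY (f u) (f v) <= K * dX u v]].

End Lipschitz.

(* For an injective F this is the inverse of F on its range. *)
Definition range_inv {X Y : Type} (F : X -> Y) (y : range F) : X :=
  projT1 (cid2 (set_valP y)).

Section Embedding.
Context {R : realType} {X Y : Type} (dX : X -> X -> R) (dY : Y -> Y -> R).

Definition bilipschitz_embedding (F : X -> Y) : Prop :=
  injective F /\
  exists C1 C2 : R, [/\ 0 < C1, 0 < C2 &
    forall u v, C1 * dX u v <= dY (F u) (F v) /\ dY (F u) (F v) <= C2 * dX u v].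

Definition distortion (F : X -> Y) : \bar R :=
  (Lip dX dY F *
   Lip (fun y z : range F => dY (\val y) (\val z)) dX (range_inv (F := F)))%E.

End Embedding.

Definition L1_dist {d} {T : measurableType d} {R : realType}
    (mu : {measure set T -> \bar R}) (f g : LspaceType1 mu) : R :=
  fine 'N[mu]_1[EFin \o ((f : T -> R) \- (g : T -> R))%R]%E.

Definition embeds_L1 {R : realType} {X : Type} (dX : X -> X -> R) (D : R) : Prop :=
  exists (d : measure_display) (T : measurableType d)
    (mu : {measure set T -> \bar R}) (F : X -> LspaceType1 mu),
    bilipschitz_embedding dX (@L1_dist d T R mu) F /\
    (distortion dX (@L1_dist d T R mu) F <= D%:E)%E.

Section ShortestPath.
Context {R : realType} {V : finType} (adj : rel V) (w : V -> V -> R).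

Definition walk_length (u : V) (p : seq V) : R := \sum_(c <- pairmap w u p) c.

Definition shortest_path_dist (u v : V) : R :=
  inf [set walk_length u p | p in [set p | path adj u p && (last u p == v)]].

End ShortestPath.

Section TwistedUnion.
Context {R : realType} {M : finType} (r : R) (d0 d1 : M -> M -> R).

Definition twisted_adj : rel (M * 'F_2) :=
  [rel u v | (u.2 == v.2) || (u.1 == v.1)].

Definition twisted_weight (u v : M * 'F_2) : R :=
  if u.2 == v.2 then (if u.2 == 0 then d0 u.1 v.1 else d1 u.1 v.1) else r.

Definition twisted_dist : M * 'F_2 -> M * 'F_2 -> R :=
  shortest_path_dist twisted_adj twisted_weight.

End TwistedUnion.

(* Main.v *)
Require Import Defs.
From HB Require Import structures.
From mathcomp Require Import all_boot all_order all_algebra.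
From mathcomp Require Import all_classical all_reals all_analysis.
From mathcomp Require Import measurable_realfun ring lra.

(* Write [delta] for the twisted metric.  A finite L1 metric is a nonnegative
   combination of cut metrics: integrate over [t] the cut of [M] by the level
   sets [{x | t < f x omega}].  Such combinations are closed under truncation:
   for a random symmetric difference [T] of the given cuts,
   [P (T separates x, y) = (1 - exp (- 2 rho (x, y))) / 2].  Let [c_i] be a cut
   combination equivalent to [d_i] and [tau] the truncation of [c_0] at scale
   [r].  Put on [M * 'F_2] the combination of [c_1] on both sheets, [tau] on
   the sheet [0] (collapsing the sheet [1] to a point), and [r] times the cut
   between the sheets.  As [d_0 <= d_1 + O(tau)], this dominates [delta]; being
   a semimetric, it is [O(delta)] as soon as this holds along the edges. *)

Set Implicit Arguments.
Unset Strict Implicit.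
Unset Printing Implicit Defensive.
Import Order.TTheory GRing.Theory Num.Theory.

Local Open Scope ring_scope.

(** * Combinations of cuts and random symmetric differences *)

Section CutDistance.
Context {R : realType} {V I : finType}.
Implicit Types (w : I -> R) (B : I -> V -> bool).

Definition cut_dist w B (x y : V) : R := \sum_i w i * (B i x != B i y)%:R.

Lemma cut_dist_ge0 w B x y : (forall i, 0 <= w i) -> 0 <= cut_dist w B x y.
Proof. by move=> w0; apply: sumr_ge0 => i _; rewrite mulr_ge0. Qed.

Lemma cut_distxx w B x : cut_dist w B x x = 0.
Proof. by rewrite /cut_dist big1// => i _; rewrite eqxx mulr0. Qed.

Lemma cut_dist_triangle w B y x z : (forall i, 0 <= w i) ->
  cut_dist w B x z <= cut_dist w B x y + cut_dist w B y z.
Proof.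
move=> w0; rewrite /cut_dist -big_split/=; apply: ler_sum => i _.
rewrite -mulrDr ler_wpM2l// -natrD ler_nat.
by case: (B i x) (B i y) (B i z) => [] [] [].
Qed.

Lemma cut_distZ c w B x y :
  cut_dist (fun i => c * w i) B x y = c * cut_dist w B x y.
Proof. by rewrite /cut_dist mulr_sumr; apply: eq_bigr => i _; rewrite mulrA. Qed.

End CutDistance.

Lemma cut_dist_exp (R : realType) (V I : finType) (w : I -> R)
    (B : I -> V -> bool) : (forall i, 0 <= w i) ->
  exists (J : finType) (m : J -> R) (S : J -> V -> bool),
    [/\ forall j, 0 <= m j, \sum_j m j = 1 &
      forall x y, cut_dist m S x y = (1 - expR (- (2 * cut_dist w B x y))) / 2].
Proof.
(* With this choice [1 - 2 * p i = expR (- (2 * w i))], so the product of these factors over the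
   cuts separating two points is the exponential of [-2] times their cut distance. *)
move=> w0; pose p i : R := (1 - expR (- (2 * w i))) / 2.
have p0 i : 0 <= p i.
  by rewrite divr_ge0// subr_ge0 -expR0 ler_expR oppr_le0 mulr_ge0.
have p1 i : 0 <= 1 - p i.
  by rewrite /p; have := expR_gt0 (- (2 * w i)); lra.
pose m (f : {ffun I -> bool}) : R := \prod_i (if f i then p i else 1 - p i).
(* [S f] is the symmetric difference of the cuts [B i] with [f i]; under the
   product Bernoulli weights [m], the expectation of [(-1)^(S x + S y)]
   factors as the product of [1 - 2 p i] over the cuts separating [x, y]. *)
pose S (f : {ffun I -> bool}) x := \big[addb/false]_i (f i && B i x).
have m1 : \sum_f m f = 1.
  rewrite -(bigA_distr_bigA (fun i b => if b then p i else 1 - p i)).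
  by apply: big1 => i _; rewrite big_bool/= subrKC.
exists _, m, S; split => // [f|x y].
  by apply: prodr_ge0 => i _; case: ifP.
have signE (f : {ffun I -> bool}) : 1 - 2 * (S f x != S f y)%:R =
    \prod_i (if f i && (B i x != B i y) then -1 else 1) :> R.
  have <- : (-1) ^+ (S f x (+) S f y) = 1 - 2 * (S f x != S f y)%:R :> R.
    by case: (S f x) (S f y) => [] [] /=; rewrite ?expr0 ?expr1; lra.
  rewrite -big_split/= (big_morph _ (signr_addb _) (erefl _)).
  apply: eq_bigr => i _.
  by case: (f i) (B i x) (B i y) => [] [] [] /=; rewrite ?expr0 ?expr1.
have H : \sum_f m f * (1 - 2 * (S f x != S f y)%:R)
    = expR (- (2 * cut_dist w B x y)) :> R.
  under eq_bigr => f _ do rewrite signE -big_split/=.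
  rewrite -(bigA_distr_bigA (fun i b => (if b then p i else 1 - p i) *
    (if b && (B i x != B i y) then -1 else 1))).
  rewrite /cut_dist mulr_sumr -sumrN expR_sum.
  apply: eq_bigr => i _; rewrite big_bool/= /p.
  by case: (_ != _) => /=; rewrite ?mulr1 ?mulr0 ?oppr0 ?expR0; lra.
rewrite -H /cut_dist -[X in X - _]m1 -sumrB mulr_suml; apply: eq_bigr => f _.
by field.
Qed.

(** * Shortest path distances compared with semimetrics *)

Section Walks.
Context {R : realType} {V : finType} (adj : rel V) (w : V -> V -> R).

Lemma walk_length_cons u v p :
  walk_length w u (v :: p) = w u v + walk_length w v p.
Proof. by rewrite /walk_length/= big_cons. Qed.

Lemma walk_length_nil u : walk_length w u [::] = 0.
Proof. by rewrite /walk_length/= big_nil. Qed.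

Lemma walk_length_ge (rho : V -> V -> R) u p :
  (forall x, rho x x <= 0) ->
  (forall y x z, rho x z <= rho x y + rho y z) ->
  (forall x y, adj x y -> rho x y <= w x y) ->
  path adj u p -> rho u (last u p) <= walk_length w u p.
Proof.
move=> rho0 tri edge; elim: p u => [|v p IH] u /=.
  by rewrite walk_length_nil.
move=> /andP[/edge uv /IH vp]; rewrite walk_length_cons.
by rewrite (le_trans (tri v _ _))// lerD.
Qed.

(** The triangle inequality along a walk bounds [rho] by the length of every walk, hence by the
    infimum. Connectedness supplies a walk; on the empty set [inf] would be a default value. *)
Lemma le_shortest_path (rho : V -> V -> R) u v :
  (forall x, rho x x <= 0) ->
  (forall y x z, rho x z <= rho x y + rho y z) ->
  (forall x y, adj x y -> rho x y <= w x y) ->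
  connect adj u v -> rho u v <= shortest_path_dist adj w u v.
Proof.
move=> rho0 tri edge /connectP[p up ->].
apply: lb_le_inf; first by exists (walk_length w u p), p => //=; rewrite up/=.
move=> _ [q /= /andP[uq /eqP <-] <-]; exact: walk_length_ge.
Qed.

Lemma shortest_path_le u p : (forall x y, adj x y -> 0 <= w x y) ->
  path adj u p -> shortest_path_dist adj w u (last u p) <= walk_length w u p.
Proof.
move=> w0 up; apply: ge_inf; last by exists p => //=; rewrite up/=.
(* The zero semimetric shows that walk lengths are bounded below, so that [inf] is a genuine
   infimum. *)
exists 0 => _ [q /= /andP[uq _] <-].
exact: (@walk_length_ge (fun _ _ => 0)).
Qed.

End Walks.

(** * Lipschitz constants and distortion *)

Section L1Distortion.
Context {R : realType} {X Y : Type} (dX : X -> X -> R) (dY : Y -> Y -> R).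

Lemma Lip_le (f : X -> Y) (K : R) : 0 <= K ->
  (forall u v, dY (f u) (f v) <= K * dX u v) -> (Lip dX dY f <= K%:E)%E.
Proof. by move=> K0 fK; apply: ereal_inf_lbound; exists K. Qed.

Lemma Lip_ge0 (f : X -> Y) : (0 <= Lip dX dY f)%E.
Proof. by apply: le_ereal_inf_tmp => _ [K [K0 _] <-]; rewrite lee_fin. Qed.

(** Each quotient [dY (f u) (f v) / dX u v] is a lower bound of the admissible constants, hence at
    most their infimum; pairs with [dX u v = 0] are settled by [K0]. *)
Lemma Lip_attained (f : X -> Y) (K0 : R) : (forall u v, 0 <= dX u v) ->
  0 <= K0 -> (forall u v, dY (f u) (f v) <= K0 * dX u v) ->
  exists2 K : R, 0 <= K &
    Lip dX dY f = K%:E /\ forall u v, dY (f u) (f v) <= K * dX u v.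
Proof.
move=> dX0 K00 fK0.
have := Lip_le K00 fK0; have := Lip_ge0 f.
case E : Lip => [K| |]// K_ge0 _; exists K; rewrite ?lee_fin// in K_ge0 *.
split=> // u v; have := dX0 u v; rewrite le_eqVlt => /predU1P[uv|uv].
  by rewrite -uv mulr0 (le_trans (fK0 u v))// -uv mulr0.
rewrite -ler_pdivrMr// -lee_fin -E; apply: le_ereal_inf_tmp => _ [L [_ fL] <-].
by rewrite lee_fin ler_pdivrMr.
Qed.

End L1Distortion.

Lemma range_invK (X Y : Type) (F : X -> Y) (y : range F) :
  F (range_inv y) = \val y.
Proof. by rewrite /range_inv; case: cid2. Qed.

Section Embedding.
Context {R : realType} {X Y : Type} (dX : X -> X -> R) (dY : Y -> Y -> R).
Hypothesis dX_ge0 : forall u v, 0 <= dX u v.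

(** Scaling [dY] by the Lipschitz constant of the inverse makes [F] noncontracting; the upper factor
    becomes the product of the two Lipschitz constants, which is the distortion. *)
Lemma distortion_scaling (F : X -> Y) (D : R) : (forall y z, 0 <= dY y z) ->
  bilipschitz_embedding dX dY F -> (distortion dX dY F <= D%:E)%E ->
  0 <= D /\ exists2 c : R, 0 <= c &
    forall u v, dX u v <= c * dY (F u) (F v) <= D * dX u v.
Proof.
move=> dY0 [Finj [c1 [c2 [c10 c20 bil]]]].
have [|A A0 [EA hA]] := @Lip_attained _ _ _ dX dY F c2 dX_ge0 (ltW c20).
  by move=> u v; have [] := bil u v.
pose dF (y z : range F) := dY (\val y) (\val z).
have [||u v|B B0 [EB hB]] := @Lip_attained _ _ _ dF dX (@range_inv _ _ F) c1^-1.
- by move=> u v; exact: dY0.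
- by rewrite invr_ge0 ltW.
- rewrite /dF -!range_invK -ler_pdivrMl ?invr_gt0// invrK.
  by have [] := bil (range_inv u) (range_inv v).
rewrite /distortion EA EB -EFinM lee_fin => ABD.
split; first exact: le_trans (mulr_ge0 A0 B0) ABD.
exists B => // u v; apply/andP; split.
  have Fr x : range F (F x) by exists x.
  pose pt x : range F := exist _ (F x) (mem_set (Fr x)).
  have ptK x : range_inv (pt x) = x by apply: Finj; rewrite range_invK.
  by have := hB (pt u) (pt v); rewrite !ptK.
apply: le_trans (ler_wpM2r (dX_ge0 u v) ABD).
by rewrite (mulrC A) -mulrA ler_wpM2l.
Qed.

Lemma bilipschitz_distortion (F : X -> Y) (c1 c2 : R) :
  0 < c1 -> 0 < c2 -> injective F ->
  (forall u v, c1 * dX u v <= dY (F u) (F v) <= c2 * dX u v) ->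
  bilipschitz_embedding dX dY F /\ (distortion dX dY F <= (c2 / c1)%:E)%E.
Proof.
move=> c10 c20 Finj bil; split.
  by split=> //; exists c1, c2; split => // u v; apply/andP.
rewrite /distortion EFinM; apply: lee_pmul; rewrite ?Lip_ge0//; apply: Lip_le.
- exact: ltW.
- by move=> u v; have /andP[] := bil u v.
- by rewrite invr_ge0 ltW.
- move=> u v; rewrite -!range_invK -ler_pdivrMl ?invr_gt0// invrK.
  by have /andP[] := bil (range_inv u) (range_inv v).
Qed.

End Embedding.

(** * L1 distances as cut combinations, by level sets *)

Section LevelCuts.
Local Open Scope classical_set_scope.
Context {d : measure_display} {T : measurableType d} {R : realType}.
Variables (mu : {measure set T -> \bar R}) (M : finType) (f : M -> T -> R).
Hypothesis mf : forall x, measurable_fun setT (f x).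

(** As [S] varies these sets partition the product; the section at [t] consists of the levels whose
    upper level set is [S]. *)
Definition level_cut (S : {set M}) : set (T * measurableTypeR R) :=
  [set p | forall x, (p.2 < f x p.1) = (x \in S)].

Lemma measurable_level_cut S : measurable (level_cut S).
Proof.
have mA x : measurable [set p : T * measurableTypeR R | p.2 < f x p.1].
  rewrite -[X in measurable X]setTI.
  have -> : [set p : T * measurableTypeR R | p.2 < f x p.1] =
      [set p | ((p.2)%:E < (f x p.1)%:E)%E].
    by apply/seteqP; split => p /=; rewrite lte_fin.
  apply: measurable_lte => //; apply/measurable_EFinP.
    exact: measurable_snd.
  exact: measurableT_comp.
have -> : level_cut S = \bigcap_(x in [set: M])
    (if x \in S then [set p | p.2 < f x p.1] else ~` [set p | p.2 < f x p.1]).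
  apply/seteqP; split => [p Sp x _|p Sp x]; last first.
    by have := Sp x I; case: ifP => _ /= => [->//|/negP/negbTE].
  by case: ifP => xS /=; rewrite Sp xS.
apply: fin_bigcap_measurable => [|x _]; first exact: finite_finset.
by case: ifP => _; last exact: measurableC.
Qed.

(** The left side is the length of the half-open interval between the two values. A level [s] lies
    in it exactly when [{z | s < f z t}] separates [x] and [y]; the levels are then sorted by this
    set. *)
Lemma lebesgue_level_cuts x y t :
  (`|f x t - f y t|%:E = \sum_(S : {set M})
    ((x \in S) != (y \in S))%:R%:E * lebesgue_measure (xsection (level_cut S) t))%E.
Proof.
pose a := Num.min (f x t) (f y t); pose b := Num.max (f x t) (f y t).
pose D := [set S : {set M} | (x \in S) != (y \in S)].
have -> : `|f x t - f y t|%:E = lebesgue_measure (`[a, b[ : set R).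
  rewrite lebesgue_measure_itv/= lte_fin /a /b.
  case: (ltgtP (f x t) (f y t)) => [xy|xy|->]; last by rewrite ltxx subrr normr0.
  - by rewrite xy ltr0_norm ?subr_lt0// opprB.
  - by rewrite xy gtr0_norm ?subr_gt0.
have -> : `[a, b[ = \bigcup_(S in D) xsection (level_cut S) t.
  have abE s : (s \in `[a, b[%R) = ((s < f x t) != (s < f y t)).
    rewrite in_itv/= ge_min lt_max.
    by case: (ltP s (f x t)); case: (ltP s (f y t)).
  apply/seteqP; split => s /=.
    rewrite abE => xys; exists [set z | s < f z t]%SET; first by rewrite /D/= !inE.
    by rewrite /xsection/= inE/= => z; rewrite inE.
  by rewrite abE => -[S DS]; rewrite /xsection/= inE/= => Ss; rewrite !Ss.
rewrite measure_fin_bigcup//=; last 2 first.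
- move=> S1 S2 _ _ [s []]; rewrite /xsection/= !inE/= => h1 h2.
  by apply/setP => z; rewrite -h1 -h2.
- by move=> S _; apply: measurable_xsection; exact: measurable_level_cut.
rewrite fsbig_mkcond (fsbigE (index_enum _)) ?index_enum_uniq//=; last first.
  by move=> S _; rewrite mem_index_enum.
apply: eq_big => [S|S _]; first exact: in_setT.
have SD : (S \in D) = ((x \in S) != (y \in S)).
  by apply/idP/idP => [/set_mem|]; last exact/mem_set.
by rewrite /patch SD; case: (_ != _); rewrite ?mul1e ?mul0e.
Qed.

(** The pointwise identity [lebesgue_level_cuts] is integrated over [mu]; only a finite sum is
    exchanged with the integral. Finiteness of the left side makes the weight of each separating [S]
    finite. *)
Lemma integral_level_cuts : exists2 w : {set M} -> R, forall S, 0 <= w S &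
  forall x y, (\int[mu]_t `|f x t - f y t|%:E < +oo)%E ->
    (\int[mu]_t `|f x t - f y t|%:E)%E = (cut_dist w (fun S x => x \in S) x y)%:E.
Proof.
pose I (S : {set M}) := (\int[mu]_t lebesgue_measure (xsection (level_cut S) t))%E.
have mx S : measurable_fun setT
    (fun t => lebesgue_measure (xsection (level_cut S) t) : \bar R).
  exact: (measurable_fun_xsection lebesgue_measure (measurable_level_cut S)).
have I0 S : (0 <= I S)%E by apply: integral_ge0.
(* For [S] empty or full, [I S] may be [+oo], which [fine] sends to [0]; such
   an [S] separates no points. *)
exists (fun S => fine (I S)) => [S|x y]; first exact: fine_ge0.
have -> : (\int[mu]_t `|f x t - f y t|%:E = \sum_(S : {set M})
    ((x \in S) != (y \in S))%:R%:E * I S)%E.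
  under eq_integral do rewrite (lebesgue_level_cuts x y).
  rewrite ge0_integral_sum//.
  - by apply: eq_bigr => S _; rewrite ge0_integralZl.
  - by move=> S; exact: measurable_funeM.
  - by move=> S t _; rewrite mule_ge0.
move=> fin; rewrite /cut_dist -sumEFin; apply: eq_bigr => S _.
case: eqVneq => /= xyS; first by rewrite mul0e mulr0.
rewrite mul1e mulr1 fineK// ge0_fin_numE// (le_lt_trans _ fin)//.
rewrite (bigD1 S)//= xyS mul1e leeDl// sume_ge0// => S' _.
by rewrite mule_ge0.
Qed.

End LevelCuts.

Lemma L1_dist_cut (d : measure_display) (T : measurableType d) (R : realType)
    (mu : {measure set T -> \bar R}) (M : finType) (F : M -> LspaceType1 mu) :
  exists2 w : {set M} -> R, forall S, 0 <= w S &
    forall x y, L1_dist (F x) (F y) = cut_dist w (fun S x => x \in S) x y.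
Proof.
have [x|w w0 wE] := @integral_level_cuts _ _ _ mu _ (fun x => F x : T -> R).
  exact: (measurable_funPT (F x)).
exists w => // x y; rewrite /L1_dist Lnorm1/= wE//.
have Fint z : mu.-integrable setT (EFin \o (F z : T -> R)).
  apply/Lfun1_integrable; rewrite inE; apply/andP; split; rewrite inE/=.
    exact: (measurable_funPT (F z)).
  exact: Lebesgue_finite.
by have /integrableP[_] := integrableB measurableT (Fint x) (Fint y).
Qed.

(** * Cut combinations realized in L1 of the counting measure *)

Section L1Class.
Local Open Scope classical_set_scope.
Context {d : measure_display} {T : measurableType d} {R : realType}.
Variable mu : {measure set T -> \bar R}.

(** A point of [LspaceType1 mu] is a class modulo almost everywhere equality; its chosen
    representative may differ from [f] on a null set, which changes no integral. *)
Lemma L1_class (f : T -> R) : mu.-integrable setT (EFin \o f) ->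
  exists F : LspaceType1 mu, f = F %[ae mu].
Proof.
move=> fint; have /measurable_EFinP mf := measurable_int _ fint.
pose fm : {mfun T >-> measurableTypeR R} :=
  HB.pack (f : T -> measurableTypeR R)
    (isMeasurableFun.Build _ _ T (measurableTypeR R) f mf).
pose F0 : {mfun_ mu, T >-> measurableTypeR R} := \pi_(_)%qT fm.
have F0f : f = F0 %[ae mu].
  have : (fm == (F0 : {mfun T >-> measurableTypeR R})
      %[mod {mfun_ mu, T >-> measurableTypeR R}])%qT.
    by rewrite reprK.
  by rewrite eqmodE => /asboolP.
have F0fin : finite_norm mu 1 F0.
  rewrite /finite_norm Lnorm1.
  have /integrableP[fmeas] := fint.
  rewrite (@ge0_ae_eq_integral _ _ _ mu setT (fun x => `|(EFin \o f) x|%E)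
    (fun x => `|(EFin \o F0) x|%E))//.
  - exact: measurableT_comp.
  - apply: measurableT_comp => //; apply/measurable_EFinP.
    exact: (measurable_funPT F0).
  - by apply: filterS F0f => t /= ft _; rewrite ft.
exists (HB.pack F0 (isFinLebesgue.Build _ _ _ mu 1%E (lexx 1%E) F0 F0fin)
  : LspaceType1 mu).
exact: F0f.
Qed.

Lemma L1_dist_ae (f g : T -> R) (F G : LspaceType1 mu) :
  measurable_fun setT f -> measurable_fun setT g ->
  f = F %[ae mu] -> g = G %[ae mu] ->
  L1_dist F G = fine (\int[mu]_x `|f x - g x|%:E).
Proof.
move=> mf mg fF gG; rewrite /L1_dist Lnorm1; congr fine.
apply: ge0_ae_eq_integral => //=.
- apply/measurable_EFinP/measurableT_comp => //; apply: measurable_funB.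
    exact: (measurable_funPT F).
  exact: (measurable_funPT G).
- by apply/measurable_EFinP/measurableT_comp => //; apply: measurable_funB.
- by apply: filterS2 fF gG => t /= ft gt _; rewrite ft ?gt.
Qed.

End L1Class.

Lemma counting_integral_fin (R : realType) (N : nat) (a : nat -> R) :
  (forall k, 0 <= a k) -> (forall k, (N <= k)%N -> a k = 0) ->
  (\int[counting]_k (a k)%:E = (\sum_(k < N) a k)%:E)%E.
Proof.
move=> a0 aN; rewrite ge0_integral_count//.
rewrite (nneseries_split 0 N)//=; last by move=> k _; rewrite lee_fin.
rewrite add0n eseries0 ?adde0 => [|k Nk _]; last first.
  by rewrite aN.
by rewrite big_mkord sumEFin.
Qed.

(** There is one coordinate per cut, equal to [w i] or [0] according to the side, so two points
    differ there by [w i] exactly when the cut separates them. The default [0] of [nth] fills the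
    coordinates beyond [#|I|]. *)
Lemma cut_dist_L1 (R : realType) (V I : finType) (w : I -> R)
    (B : I -> V -> bool) : (forall i, 0 <= w i) ->
  exists F : V -> LspaceType1 (counting : {measure set nat -> \bar R}),
    forall u v, L1_dist (F u) (F v) = cut_dist w B u v.
Proof.
move=> w0.
pose f v : nat -> R := nth 0 [seq w i * (B i v)%:R | i <- enum I].
have sz v : size [seq w i * (B i v)%:R | i <- enum I] = #|I|.
  by rewrite size_map cardE.
have fN v k : (#|I| <= k)%N -> f v k = 0 by move=> Ik; rewrite /f nth_default ?sz.
have fE v (k : 'I_#|I|) : f v k = w (enum_val k) * (B (enum_val k) v)%:R.
  have i0 := enum_val k; rewrite /f (nth_map i0) -?cardE//.
  by rewrite -(enum_val_nth i0).
have fint v : (counting : {measure set nat -> \bar R}).-integrable setT (EFin \o f v).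
  apply/integrableP; split => //=.
  rewrite (@counting_integral_fin _ #|I| (fun k => `|f v k|)) ?ltry// => k Ik.
  by rewrite fN ?normr0.
have /choice[F FE] v := L1_class (fint v).
exists F => u v; rewrite (@L1_dist_ae _ _ _ _ (f u) (f v))//.
rewrite (@counting_integral_fin _ #|I| (fun k => `|f u k - f v k|))//=; last first.
  by move=> k Ik; rewrite !fN ?subrr ?normr0.
rewrite /cut_dist [RHS](reindex_onto enum_val enum_rank)/=; last first.
  by move=> i _; rewrite enum_rankK.
apply: eq_big => [k|k _]; first by rewrite enum_valK eqxx.
rewrite !fE -mulrBr normrM ger0_norm//; congr (_ * _).
case: (B _ u) (B _ v) => [] [];
  by rewrite /= ?subrr ?subr0 ?sub0r ?normrN ?normr0 ?normr1.
Qed.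

(** * L1 embeddability in terms of cuts, and truncation *)

Lemma embeds_L1_cut_dist (R : realType) (M : finType) (dM : M -> M -> R) (D : R) :
  (forall x y, 0 <= dM x y) -> embeds_L1 dM D ->
  0 <= D /\ exists2 w : {set M} -> R, forall S, 0 <= w S &
    forall x y, dM x y <= cut_dist w (fun S x => x \in S) x y <= D * dM x y.
Proof.
move=> dM0 [d [T [mu [F [bil distF]]]]].
have [|D0 [c c0 cF]] := distortion_scaling dM0 _ bil distF.
  by move=> y z; rewrite fine_ge0// Lnorm_ge0.
have [w w0 wE] := L1_dist_cut F.
(* The weights absorb the scale [c], which normalizes the lower constant to [1]. *)
split=> //; exists (fun S => c * w S) => [S|x y]; first exact: mulr_ge0.
by rewrite cut_distZ -wE.
Qed.

Lemma cut_dist_embeds_L1 (R : realType) (V I : finType) (dV : V -> V -> R)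
    (w : I -> R) (B : I -> V -> bool) (c1 c2 : R) :
  0 < c1 -> 0 < c2 -> (forall i, 0 <= w i) ->
  (forall u v, u != v -> 0 < cut_dist w B u v) ->
  (forall u v, c1 * dV u v <= cut_dist w B u v <= c2 * dV u v) ->
  embeds_L1 dV (c2 / c1).
Proof.
move=> c10 c20 w0 sep bil; have [F FE] := cut_dist_L1 B w0.
exists _, nat, (counting : {measure set nat -> \bar R}), F.
apply: bilipschitz_distortion => // [u v Fuv|u v]; last by rewrite FE.
by apply: contraTeq isT => /sep; rewrite -FE Fuv FE cut_distxx ltxx.
Qed.

(** With [t = 2 * c / r], the new distance is [tau = r * (1 - expR (- t)) / 2]. The bounds
    [1 - t <= expR (- t) <= 1 / (1 + t)] give [c * r / (r + 2 * c) <= tau <= c]. *)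
Lemma truncate_cut_dist (R : realType) (V I : finType) (w : I -> R)
    (B : I -> V -> bool) (r : R) : 0 < r -> (forall i, 0 <= w i) ->
  exists (J : finType) (m : J -> R) (S : J -> V -> bool),
    [/\ forall j, 0 <= m j, \sum_j m j = r &
      forall x y, cut_dist m S x y <= cut_dist w B x y /\
        Num.min (cut_dist w B x y) (2 * r) <= 5 * cut_dist m S x y].
Proof.
move=> r0 w0; have wr0 i : 0 <= r^-1 * w i by rewrite mulr_ge0// invr_ge0 ltW.
have [J [m [S [m0 m1 mE]]]] := cut_dist_exp B wr0.
exists J, (fun j => r * m j), S; split => [j||x y].
- by rewrite mulr_ge0// ltW.
- by rewrite -mulr_sumr m1 mulr1.
rewrite cut_distZ mE cut_distZ; set c := cut_dist w B x y.
set E := expR _; set t := 2 * (r^-1 * c).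
have ct : 2 * c = r * t by rewrite /t; field; rewrite gt_eqF.
have c0 : 0 <= c by exact: cut_dist_ge0.
have t0 : 0 <= t by rewrite !mulr_ge0// invr_ge0 ltW.
have Et : 1 - t <= E by rewrite /E expR_ge1Dx.
have E1t : E * (1 + t) <= 1.
  have EV : E * expR t = 1 by rewrite -expRD addNr expR0.
  rewrite -[leRHS]EV ler_wpM2l ?expR_ge0//.
  exact: expR_ge1Dx.
set tau := r * _.
have tauc : tau <= c by rewrite /tau; nra.
have tau_lb : c * r <= tau * (r + 2 * c).
  have -> : tau * (r + 2 * c) = r * r / 2 * (1 + t - E * (1 + t)).
    by rewrite ct /tau; field.
  have -> : c * r = r * r / 2 * t by rewrite (_ : c = r * t / 2); [field|lra].
  have rr0 : 0 <= r * r / 2 by nra.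
  by rewrite ler_wpM2l//; lra.
split=> //; rewrite ge_min; apply/orP.
(* The lower bound on [tau] increases with [c], and at [c = 2 * r] its denominator is [5 * r]: this
   is the origin of the constant [5]. *)
by have [c2r|c2r] := leP c (2 * r); [left|right]; nra.
Qed.

(** * Cuts and short paths in the twisted union *)

Section TwistedCuts.
Context {R : realType} {M I J : finType}.
Variables (w : I -> R) (B : I -> M -> bool) (m : J -> R) (S : J -> M -> bool) (r : R).

(** All of the sheet [1] is on the [false] side of each cut built from [S]; ['I_1] indexes the
    single cut between the sheets. *)
Definition twisted_cut (k : I + J + 'I_1) (u : M * 'F_2) : bool :=
  match k with
  | inl (inl i) => B i u.1
  | inl (inr j) => (u.2 == 0) && S j u.1
  | inr _ => u.2 == 0
  end.

Definition twisted_cut_weight (k : I + J + 'I_1) : R :=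
  match k with inl (inl i) => w i | inl (inr j) => m j | inr _ => r end.

Definition twisted_cut_dist := cut_dist twisted_cut_weight twisted_cut.

Lemma twisted_cut_distE u v : twisted_cut_dist u v =
  cut_dist w B u.1 v.1 +
  \sum_j m j * ((u.2 == 0) && S j u.1 != (v.2 == 0) && S j v.1)%:R +
  r * ((u.2 == 0) != (v.2 == 0))%:R.
Proof. by rewrite /twisted_cut_dist /cut_dist !big_sumType big_ord1. Qed.

End TwistedCuts.

Lemma F2_separated (a b : 'F_2) : a != b -> (a == 0) != (b == 0).
Proof. by move: a b => [[|[|]]// ?] [[|[|]]// ?]. Qed.

Section TwistedDist.
Context {R : realType} {M : finType} (r : R) (d0 d1 : M -> M -> R).
Hypotheses (r0 : 0 < r) (md0 : is_metric d0) (md1 : is_metric d1).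

Lemma twisted_weight_ge0 u v : 0 <= twisted_weight r d0 d1 u v.
Proof.
rewrite /twisted_weight; case: ifP => _; last exact: ltW.
by case: ifP => _; exact: metric_ge0.
Qed.

Lemma twisted_connect u v : connect (@twisted_adj M) u v.
Proof.
apply: (@connect_trans _ _ (u.1, v.2)); apply: connect1; rewrite /twisted_adj/=.
- by rewrite eqxx orbT.
- by rewrite eqxx.
Qed.

Lemma twisted_dist_edge u v : twisted_adj u v ->
  twisted_dist r d0 d1 u v <= twisted_weight r d0 d1 u v.
Proof.
move=> uv; have w0 x y (_ : @twisted_adj M x y) := twisted_weight_ge0 x y.
have := @shortest_path_le _ _ _ _ u [:: v] w0; rewrite /= uv => /(_ isT).
by rewrite walk_length_cons walk_length_nil addr0.
Qed.

(** The horizontal step is taken on the sheet [1] in both cases, before or after the vertical edge: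
    [d1] is the metric whose cuts act across the sheets. *)
Lemma twisted_dist_cross x y a b : a != b ->
  twisted_dist r d0 d1 (x, a) (y, b) <= r + d1 x y.
Proof.
move=> ab; have w0 x y (_ : @twisted_adj M x y) := twisted_weight_ge0 x y.
have [a0|a1] := eqVneq a 0.
  have := @shortest_path_le _ _ _ _ (x, a) [:: (x, b); (y, b)] w0.
  rewrite /twisted_adj/= !eqxx orbT/= => /(_ isT).
  rewrite !walk_length_cons walk_length_nil addr0 {2 3}/twisted_weight/=.
  by rewrite eqxx (negbTE ab) -{1}a0 eq_sym (negbTE ab).
have := @shortest_path_le _ _ _ _ (x, a) [:: (y, a); (y, b)] w0.
rewrite /twisted_adj/= !eqxx orbT/= => /(_ isT).
rewrite !walk_length_cons walk_length_nil addr0 {2 3}/twisted_weight/=.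
by rewrite eqxx (negbTE ab) (negbTE a1) addrC.
Qed.

End TwistedDist.

(** * Comparison of the cut combination with the twisted metric *)

Theorem corollary5p3 (R : realType) (D0 D1 C : R) (hC : 0 < C) :
  exists D : R,
    forall (M : finType) (d0 d1 : M -> M -> R) (r : R),
      0 < r ->
      is_metric d0 -> is_metric d1 ->
      (forall x y : M, `|d0 x y - d1 x y| <= 2 * r) ->
      embeds_L1 d0 D0 -> embeds_L1 d1 D1 ->
      (forall x y : M, d1 x y <= C * d0 x y) ->
      embeds_L1 (twisted_dist r d0 d1) D.
Proof.
(* The lower constant [5^-1] comes from truncation. In the numerator, [D1 * C + D0] serves the edges
   of the sheet [0], [D1] those of the sheet [1], and [2] the vertical ones. *)
exists ((D1 * C + D0 + D1 + 2) / 5^-1).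
move=> M d0 d1 r r0 md0 md1 d01 e0 e1 d1C.
have [D0_ge0 [w0 w0_ge0 w0E]] := embeds_L1_cut_dist (metric_ge0 md0) e0.
have [D1_ge0 [w1 w1_ge0 w1E]] := embeds_L1_cut_dist (metric_ge0 md1) e1.
have [J [m [S [m_ge0 m_sum mE]]]] :=
  truncate_cut_dist (fun (A : {set M}) x => x \in A) r0 w0_ge0.
pose rho := twisted_cut_dist w1 (fun (A : {set M}) x => x \in A) m S r.
have W_ge0 k : 0 <= twisted_cut_weight w1 m r k.
  by case: k => [[i|j]|k] /=; rewrite ?w1_ge0 ?m_ge0 ?(ltW r0).
have trunc_ge0 (u v : M * 'F_2) : 0 <=
    \sum_j m j * ((u.2 == 0) && S j u.1 != (v.2 == 0) && S j v.1)%:R.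
  by apply: sumr_ge0 => j _; rewrite mulr_ge0.
(* Where the minimum in [mE] is the cut distance, it dominates [d0]; where it is [2 * r], it
   dominates [d0 - d1]. *)
have d0_ub x y : d0 x y <= d1 x y + 5 * cut_dist m S x y.
  have [/andP[c0 _] [_ mxy]] := (w0E x y, mE x y).
  have := d01 x y; rewrite ler_norml => /andP[_ d01xy].
  have := metric_ge0 md1 x y; move: mxy; rewrite ge_min => /orP[] *; lra.
have dw1 x y : d1 x y <= cut_dist w1 (fun A x => x \in A) x y.
  by have /andP[] := w1E x y.
have c_gt0 : 0 < D1 * C + D0 + D1 + 2 by have := mulr_ge0 D1_ge0 (ltW hC); lra.
have sheet0 x y : rho (x, 0) (y, 0) =
    cut_dist w1 (fun A x => x \in A) x y + cut_dist m S x y.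
  by rewrite /rho twisted_cut_distE/= mulr0 addr0.
have sheet1 x y a : a != 0 -> rho (x, a) (y, a) =
    cut_dist w1 (fun A x => x \in A) x y.
  move=> /negbTE a0; rewrite /rho twisted_cut_distE/= a0/= mulr0 addr0.
  by rewrite big1 ?addr0// => j _; rewrite mulr0.
have cross x y a b : a != b -> cut_dist w1 (fun A x => x \in A) x y + r <=
    rho (x, a) (y, b).
  move=> ab; have := trunc_ge0 (x, a) (y, b).
  rewrite /rho twisted_cut_distE/=.
  by rewrite (F2_separated ab) mulr1; lra.
apply: (@cut_dist_embeds_L1 _ _ _ _ _
  (twisted_cut (fun (A : {set M}) x => x \in A) S) _ _ _ c_gt0 W_ge0).
- by rewrite invr_gt0.
- move=> [x a] [y b] uv; rewrite -[ltRHS]/(rho (x, a) (y, b)).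
  have [ab|ab] := eqVneq a b; last first.
    by have := cross x y _ _ ab; have := dw1 x y; have := metric_ge0 md1 x y; lra.
  have d1_gt0 : 0 < d1 x y.
    rewrite lt_def metric_ge0// andbT; apply: contraNneq uv.
    by move=> /(metric_eq0 md1) ->; rewrite ab.
  rewrite -ab; have [->|a0] := eqVneq a 0.
    by rewrite sheet0; have := cut_dist_ge0 S x y m_ge0; have := dw1 x y; lra.
  by rewrite sheet1//; have := dw1 x y; lra.
move=> [x a] [y b]; rewrite -[X in _ <= X <= _]/(rho (x, a) (y, b)); apply/andP; split.
  rewrite ler_pdivrMl//.
  have [<-|ab] := eqVneq a b; last first.
    apply: le_trans (twisted_dist_cross _ _ _ _ _ ab) _ => //.
    by have := cross x y _ _ ab; have := dw1 x y; have := metric_ge0 md1 x y; lra.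
  apply: le_trans (twisted_dist_edge _ _ _ _) _ => //.
    by rewrite /twisted_adj/= eqxx.
  rewrite /twisted_weight/= eqxx; have [->|a0] := eqVneq a 0.
    rewrite sheet0; have := d0_ub x y; have := dw1 x y.
    by have := metric_ge0 md1 x y; lra.
  by rewrite sheet1//; have := dw1 x y; have := metric_ge0 md1 x y; lra.
(* Divided by the upper constant, [rho] is a semimetric, so it suffices to bound it on the edges. *)
rewrite mulrC -ler_pdivrMr//.
apply: (le_shortest_path (rho := fun u v => rho u v / _)); last exact: twisted_connect.
- by move=> u; rewrite /rho /twisted_cut_dist cut_distxx mul0r.
- by move=> v u z; rewrite -mulrDl ler_pM2r ?invr_gt0//; exact: cut_dist_triangle.
move=> {x a y b} [x a] [y b]; rewrite ler_pdivrMr// /twisted_adj/= /twisted_weight/=.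
have D1C_ge0 := mulr_ge0 D1_ge0 (ltW hC).
have [<- _|ab /= /eqP <-] := eqVneq a b.
  have [/andP[_ w1u] [mw0 _]] := (w1E x y, mE x y).
  have := metric_ge0 md1 x y; have := metric_ge0 md0 x y => d0xy d1xy.
  have [->|a0] := eqVneq a 0.
    have /andP[_ w0u] := w0E x y; rewrite sheet0.
    (* On the sheet [0] the cuts equivalent to [d1] have to be paid for by [d0], at the price of
       [C]. *)
    have := ler_wpM2l D1_ge0 (d1C x y); rewrite mulrA => D1C.
    by have := mulr_ge0 D1_ge0 d0xy; lra.
  rewrite sheet1//; have := mulr_ge0 D0_ge0 d1xy; have := mulr_ge0 D1C_ge0 d1xy; lra.
rewrite /rho twisted_cut_distE/= cut_distxx add0r.
(* A vertical edge may cross every truncated cut, but their total weight is [r]. *)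
have trunc_le : \sum_j m j * ((a == 0) && S j x != (b == 0) && S j x)%:R <= r.
  rewrite -m_sum; apply: ler_sum => j _.
  by rewrite ler_piMr//; case: (_ != _).
have sep_le : r * ((a == 0) != (b == 0))%:R <= r.
  by rewrite ler_piMr ?(ltW r0)//; case: (_ != _).
have := mulr_ge0 D0_ge0 (ltW r0); have := mulr_ge0 D1_ge0 (ltW r0).
by have := mulr_ge0 D1C_ge0 (ltW r0); lra.
Qed.
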